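(* Let $G$ be a finite group. Then $$1+\sum_{p\mid |G|} v_p(\exp G)\;\le\;\eta(G)\;\le\;\tau(\exp G),$$ where the sum runs over the primes $p$ dividing $|G|$. The lower bound is an equality if and only if $G$ is a CP-group, that is, every element of $G$ has prime-power order. The upper bound is an equality if and only if $\omega(G)=\{d\in\mathbb{N}: d\mid \exp G\}$.
   Context: For a finite group $G$, $\omega(G)$ denotes the set of orders of elements of $G$ and $\eta(G)=|\omega(G)|$. The exponent $\exp G$ is the least common multiple of the orders of the elements of $G$. $\tau(m)$ is the number of positive divisors of $m$, and $v_p(m)$ is the exponent of the prime $p$ in the factorisation of $m$ ($0$ if $p\nmid m$). The order $1$ of the identity counts as a prime power ($p^0$) in the definition of CP-group. *)

(* Defs.v *)
From mathcomp Require Import all_boot all_fingroup all_solvable.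

Set Implicit Arguments.
Unset Strict Implicit.
Unset Printing Implicit Defensive.

Local Open Scope group_scope.

(* omega G is a duplicate-free list, so its size is the cardinality of the
   set of element orders. *)
Definition omega (gT : finGroupType) (G : {set gT}) : seq nat :=
  undup [seq #[x] | x in G].

Definition eta (gT : finGroupType) (G : {set gT}) : nat := size (omega G).

(* Only meaningful for 0 < m: divisors 0 is [:: 1]. *)
Definition tau (m : nat) : nat := size (divisors m).

(* k = 0 is allowed, so the order 1 of the identity is a prime power. *)
Definition prime_power (n : nat) : Prop :=
  exists p k : nat, prime p /\ n = (p ^ k)%N.

Definition CP_group (gT : finGroupType) (G : {set gT}) : Prop :=
  forall x : gT, x \in G -> prime_power #[x].

(* Main.v *)
Require Import Defs.
From mathcomp Require Import all_boot all_fingroup all_solvable.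

Set Implicit Arguments.
Unset Strict Implicit.

(** The three quantities are the sizes of nested duplicate-free lists: the
    prime-power divisors of [exponent G] (the number [1] included), the element
    orders of [G], and all the divisors of [exponent G].  Both inequalities
    are then inclusions, and an inclusion of finite sets is an equality of
    cardinals exactly when the reverse inclusion holds.

    The only inclusion with group-theoretic content is the first.  The
    [p]-part of the exponent of [G] is the exponent of a Sylow [p]-subgroup,
    which, being nilpotent, has an element of that order; a power of this
    element has order any given smaller power of [p] ([mem_omega_pfactor]).
    Conversely every element order divides [exponent G], so the reverse
    inclusion says that every element order is a prime power. *)

Lemma eq_size_uniq_sub (T : eqType) (s1 s2 : seq T) :
    uniq s1 -> uniq s2 -> {subset s1 <= s2} ->
  size s1 = size s2 <-> {subset s2 <= s1}.
Proof.
move=> Us1 Us2 s12; split=> [eq_sz x | s21].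
  by have [|_ ->] := uniq_min_size Us1 s12; rewrite ?eq_sz.
by apply/eqP; rewrite eqn_leq !uniq_leq_size.
Qed.

(** The exponents start at [1] and the divisor [1] is added separately, since
    [p ^ 0] would be repeated for every prime [p]. *)
Definition prime_power_divisors (m : nat) : seq nat :=
  1%N :: [seq (p ^ k)%N | p <- primes m, k <- iota 1 (logn p m)].

Lemma size_prime_power_divisors m :
  size (prime_power_divisors m) = (1 + \sum_(p <- primes m) logn p m)%N.
Proof.
rewrite /= size_allpairs_dep sumnE big_map add1n.
by congr _.+1; apply: eq_bigr => p _; rewrite size_iota.
Qed.

Lemma uniq_prime_power_divisors m : uniq (prime_power_divisors m).
Proof.
rewrite /=; apply/andP; split.
  apply/allpairsPdep=> -[p [k [+ + /esym/eqP]]].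
  rewrite mem_primes mem_iota => /andP[p_pr _] /andP[k_gt0 _].
  by rewrite -(exp1n k) eqn_exp2r // => /eqP p1; rewrite p1 in p_pr.
apply: allpairs_uniq_dep => [|p _|]; rewrite ?primes_uniq ?iota_uniq //.
move=> _ _ /allpairsPdep[p [k [p_m k_m ->]]] /allpairsPdep[q [l [q_m l_m ->]]].
move: p_m q_m k_m l_m => /=; rewrite !mem_primes !mem_iota.
move=> /andP[p_pr _] /andP[q_pr _]; case: k l => // k [//|l] _ _ eq_pq.
(* The base of a nontrivial prime power is its least prime divisor. *)
have eq_b : p = q by rewrite -(pdiv_pfactor k p_pr) eq_pq pdiv_pfactor.
by rewrite -eq_b in eq_pq *; rewrite (expnI (prime_gt1 p_pr) eq_pq).
Qed.

Lemma mem_prime_power_divisors m d : (0 < m)%N ->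
  d \in prime_power_divisors m <-> prime_power d /\ d %| m.
Proof.
move=> m_gt0; rewrite in_cons; split=> [/predU1P[-> | ] | [[p [k [p_pr ->]]]]].
- by split; rewrite ?dvd1n //; exists 2%N, 0%N.
- case/allpairsPdep=> p [k []]; rewrite mem_primes mem_iota => /andP[p_pr _].
  by case/andP=> _ le_k ->; split; [exists p, k | rewrite pfactor_dvdn].
case: k => [|k] dv_m; first by rewrite expn0 eqxx.
apply/orP; right; apply/allpairsPdep; exists p, k.+1; split=> //.
  by rewrite mem_primes p_pr m_gt0 (dvdn_trans _ dv_m) // dvdn_exp.
by rewrite mem_iota /= add1n ltnS -pfactor_dvdn.
Qed.

Section ElementOrders.

Variables (gT : finGroupType) (G : {group gT}).

Lemma uniq_omega : uniq (omega G).
Proof. exact: undup_uniq. Qed.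

Lemma omegaP d : reflect (exists2 x, x \in G & d = #[x]%g) (d \in omega G).
Proof. by rewrite mem_undup; apply: imageP. Qed.

Lemma omega_dvdn d e : e \in omega G -> d %| e -> d \in omega G.
Proof.
case/omegaP=> x Gx -> dv_d; apply/omegaP; exists (x ^+ (#[x] %/ d))%g.
  exact: groupX.
by rewrite orderXdiv ?dvdn_div // divnA // mulKn // order_gt0.
Qed.

Lemma dvdn_exponent_omega d : d \in omega G -> d %| exponent G.
Proof. by case/omegaP=> x Gx ->; apply: dvdn_exponent. Qed.

(** For a single prime the exponent is attained: a Sylow subgroup is nilpotent,
    and its exponent is the [p]-part of that of [G]. *)
Lemma mem_omega_pfactor p k :
  prime p -> p ^ k %| exponent G -> (p ^ k)%N \in omega G.
Proof.
move=> p_pr dv_pk; have [S sylS] := Sylow_exists p G.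
have [x Sx expS] := exponent_witness (pgroup_nil (pHall_pgroup sylS)).
apply: (@omega_dvdn _ #[x]%g).
  by apply/omegaP; exists x; rewrite // (subsetP (pHall_sub sylS)).
rewrite -expS (exponent_Hall sylS) p_part dvdn_exp2l //.
by rewrite -pfactor_dvdn ?exponent_gt0.
Qed.

Lemma prime_power_divisors_sub_omega :
  {subset prime_power_divisors (exponent G) <= omega G}.
Proof.
move=> d /(mem_prime_power_divisors _ (exponent_gt0 G))[[p [k [p_pr ->]]]].
exact: mem_omega_pfactor.
Qed.

Lemma omega_sub_divisors : {subset omega G <= divisors (exponent G)}.
Proof.
by move=> d /dvdn_exponent_omega; rewrite dvdn_divisors ?exponent_gt0.
Qed.

Lemma CP_group_omega_sub :
  CP_group G <-> {subset omega G <= prime_power_divisors (exponent G)}.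
Proof.
have expG_gt0 := exponent_gt0 G; split=> [CP _ /omegaP[x Gx ->] | sub x Gx].
  by apply/mem_prime_power_divisors=> //; split; [exact: CP|exact: dvdn_exponent].
have /sub/(mem_prime_power_divisors _ expG_gt0)[] // : #[x]%g \in omega G.
by apply/omegaP; exists x.
Qed.

End ElementOrders.

Theorem theorem4p3 (gT : finGroupType) (G : {group gT}) :
  [/\ (1 + \sum_(p <- primes #|G|) logn p (exponent G) <= eta G)%N,
      (eta G <= tau (exponent G))%N,
      (1 + \sum_(p <- primes #|G|) logn p (exponent G))%N = eta G <-> CP_group G
    & eta G = tau (exponent G) <->
      (forall d : nat, d \in omega G <-> d %| exponent G) ].
Proof.
have [Upp Uom] := (uniq_prime_power_divisors (exponent G), uniq_omega G).
have [pp_om om_div] := (prime_power_divisors_sub_omega (G := G),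
                        omega_sub_divisors (G := G)).
have mem_div d : (d \in divisors (exponent G)) = (d %| exponent G).
  by rewrite dvdn_divisors ?exponent_gt0.
rewrite -primes_exponent -size_prime_power_divisors; split.
- exact: uniq_leq_size.
- exact: uniq_leq_size.
- apply: (iff_trans (eq_size_uniq_sub Upp Uom pp_om)).
  exact: iff_sym (CP_group_omega_sub G).
apply: (iff_trans (eq_size_uniq_sub Uom (divisors_uniq _) om_div)).
split=> [div_om d | om_iff d]; last by rewrite mem_div => /om_iff.
by split=> [/om_div | dv_d]; [rewrite mem_div | apply: div_om; rewrite mem_div].
Qed.
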